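(* Let $\mathcal{A}$ be a real symmetric positive definite tensor of order $m$ and dimension $n$ with real H-spectrum $\lambda(\mathcal{A}) = (\lambda_1(\mathcal{A}),\ldots,\lambda_d(\mathcal{A}))$, $\lambda_1(\mathcal{A}) \ge \cdots \ge \lambda_d(\mathcal{A}) > 0$, $d = n(m-1)^{n-1}$, and let $T = \sum_i\lambda_i(\mathcal{A})$, $S = \sum_i \lambda_i(\mathcal{A})^2$, $p_3 = \sum_i \lambda_i(\mathcal{A})^3$, $D = \prod_i \lambda_i(\mathcal{A})$, $\lambda_{\max}(\mathcal{A}) = \lambda_1(\mathcal{A})$. Then: (i) $B_4^+(T,S,p_3,D) \ge \lambda_{\max}(\mathcal{A})$. (ii) If $B_4^+(T,S,p_3,D) = \lambda_{\max}(\mathcal{A})$, then the H-spectrum of $\mathcal{A}$ takes at most four distinct values. (iii) If the H-spectrum of $\mathcal{A}$ takes at most four distinct values and $\lambda(\mathcal{A})$ is the unique maximizer of $\lambda_1$ over $\mathcal{F}_4(T,S,p_3;D)$, then $B_4^+(T,S,p_3,D) = \lambda_{\max}(\mathcal{A})$.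
   Context: The H-eigenvalues of a symmetric tensor $\mathcal{A} = (a_{i_1\cdots i_m})$ are the scalars $\lambda$ with $\mathcal{A}x^{m-1} = \lambda x^{[m-1]}$ for some $x \ne 0$, where $(\mathcal{A}x^{m-1})_i = \sum_{i_2,\ldots,i_m} a_{i i_2\cdots i_m}x_{i_2}\cdots x_{i_m}$ and $x^{[m-1]} = (x_1^{m-1},\ldots,x_n^{m-1})^T$; counted with algebraic multiplicity there are $d = n(m-1)^{n-1}$ of them, and all are assumed real and positive. Positive definite means $\mathcal{A}x^m>0$ for all $x\in\mathbb{R}^n\setminus\{0\}$. $\mathcal{F}_4(T,S,p_3;D) := \{\lambda \in \mathbb{R}^d_{>0} : \sum_i \lambda_i = T,\ \sum_i \lambda_i^2 = S,\ \sum_i \lambda_i^3 = p_3,\ \prod_i \lambda_i = D\}$ and $B_4^+(T,S,p_3,D) := \max\{\lambda_1 : \lambda \in \mathcal{F}_4(T,S,p_3;D)\}$. *)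

(* Defs.v *)
From mathcomp Require Import all_boot all_order all_algebra all_fingroup.
From mathcomp Require Import classical_sets reals.
From mathcomp Require Import complex.
From mathcomp Require Import mpoly.

Set Implicit Arguments.
Unset Strict Implicit.
Unset Printing Implicit Defensive.

Import Order.TTheory GRing.Theory Num.Theory.
Local Open Scope ring_scope.

Section Tensor.
Context {K : comNzRingType} {m n : nat}.

(* The entry a_{i_1 ... i_m} of [A] is [A [tuple i_1; ...; i_m]]. *)
Definition tensor : Type := m.-tuple 'I_n -> K.

Definition tensor_sym (A : tensor) : Prop :=
  forall (s : 'S_m) (t : m.-tuple 'I_n), A [tuple tnth t (s j) | j < m] = A t.

Definition tensor_form (A : tensor) (x : 'rV[K]_n) : K :=
  \sum_(t : m.-tuple 'I_n) A t * \prod_(j <- t) x 0 j.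

(* (A x^{m-1})_i: the sum runs over the index tuples (i, i_2, ..., i_m). *)
Definition tensor_apply (A : tensor) (x : 'rV[K]_n) (i : 'I_n) : K :=
  \sum_(t : m.-tuple 'I_n | ohead t == Some i)
    A t * \prod_(j <- behead t) x 0 j.

End Tensor.
Arguments tensor : clear implicits.

Definition tensor_posdef (R : realType) (m n : nat) (A : tensor R m n) : Prop :=
  forall x : 'rV[R]_n, x != 0 -> 0 < tensor_form A x.

(* Eigenvalues and eigenvectors are sought over the complex numbers: this is
   the setting in which there are n (m - 1)^(n - 1) of them with
   multiplicity. *)
Definition H_eigenvalue (R : realType) (m n : nat) (A : tensor R m n)
    (mu : R[i]) : Prop :=
  exists2 x : 'rV[R[i]]_n, x != 0 &
    forall i, tensor_apply (fun t => (A t)%:C%C) x i = mu * x 0 i ^+ m.-1.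

(* The resultant of n forms of degree k in n variables is a polynomial with
   integer coefficients in their generic coefficients u_(i, a), where i is the
   index of the form and a a monomial of degree k; [coef_index] enumerates the
   pairs (i, a). *)
Definition coef_index (n k : nat) : finType :=
  ('I_n * {a : 'X_{1..n < k.+1} | mdeg a == k})%type.

Definition form_coefs (K : comNzRingType) (n k : nat)
    (F : 'I_n -> {mpoly K[n]}) (j : 'I_#|coef_index n k|) : K :=
  (F (enum_val j).1)@_(val (val (enum_val j).2)).

Definition eval_at_forms (K : comNzRingType) (n k : nat)
    (P : {mpoly int[#|coef_index n k|]}) (F : 'I_n -> {mpoly K[n]}) : K :=
  mmap intr (form_coefs (k := k) F) P.

(* The three properties that determine the multivariate resultant: it is
   irreducible over the integers, it takes the value 1 at x_1^k, ..., x_n^k,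
   and it vanishes exactly at the systems of complex forms that have a
   nontrivial common zero. *)
Definition is_resultant (R : realType) (n k : nat)
    (P : {mpoly int[#|coef_index n k|]}) : Prop :=
  [/\ P \isn't a GRing.unit /\
      (forall p q, P = p * q -> p \is a GRing.unit \/ q \is a GRing.unit),
      eval_at_forms P (fun i => 'X_i ^+ k : {mpoly int[n]}) = 1 &
      forall F : 'I_n -> {mpoly R[i][n]}, (forall i, F i \is k.-homog) ->
        eval_at_forms P F = 0 <->
        exists2 x : 'rV[R[i]]_n, x != 0 & forall i, (F i).@[x 0] = 0].

Definition multi_resultant (R : realType) (n k : nat) :
    {mpoly int[#|coef_index n k|]} :=
  xget 0 [set P | is_resultant R P]%classic.

(* The resultant of the forms lambda x_i^{m-1} - (A x^{m-1})_i in x, a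
   polynomial in lambda. *)
Definition tensor_char_poly (R : realType) (m n : nat) (A : tensor R m n) :
    {poly R} :=
  eval_at_forms (multi_resultant R n m.-1) (fun i : 'I_n =>
    ('X%:MP * 'X_i ^+ m.-1 -
     tensor_apply (fun t => (A t)%:P%:MP) (\row_j 'X_j) i
     : {mpoly {poly R}[n]})).

(* The algebraic multiplicity of an H-eigenvalue is its multiplicity as a root
   of the characteristic polynomial.  Since [lam] is real, [H_spectrum A lam]
   implies that all H-eigenvalues of [A] are real. *)
Definition H_spectrum (R : realType) (m n : nat) (A : tensor R m n)
    (lam : seq R) : Prop :=
  (forall x, x \in lam -> H_eigenvalue A x%:C%C) /\
  (forall mu : R[i], H_eigenvalue A mu ->
     count_mem mu [seq x%:C%C | x <- lam] =
     mup mu (map_poly (real_complex R) (tensor_char_poly A))).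

Definition power_sum (R : realType) (k : nat) (lam : seq R) : R :=
  \sum_(x <- lam) x ^+ k.

Definition F4 (R : realType) (d : nat) (T S p3 D : R) : set (d.-tuple R) :=
  [set lam : d.-tuple R | [/\ (forall i, 0 < tnth lam i),
     power_sum 1 lam = T, power_sum 2 lam = S, power_sum 3 lam = p3 &
     \prod_(x <- lam) x = D]]%classic.

(* The maximum of the first coordinate over [F4]; it is 0 if there is no
   maximum. *)
Definition B4plus (R : realType) (d : nat) (T S p3 D : R) : R :=
  let X := [set lam`_0 | lam in @F4 R d T S p3 D]%classic in
  xget 0 (X `&` ubound X)%classic.

(* [F4] is invariant under permutations of the coordinates, so uniqueness of
   a maximizer is understood up to reordering. *)
Definition unique_maximizer (R : realType) (d : nat) (T S p3 D : R)
    (lam : d.-tuple R) : Prop :=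
  [/\ F4 T S p3 D lam,
      (forall mu : d.-tuple R, F4 T S p3 D mu -> mu`_0 <= lam`_0) &
      (forall mu : d.-tuple R, F4 T S p3 D mu -> mu`_0 = lam`_0 ->
         perm_eq mu lam)].

(* Main.v *)
(* The set F4 is compact: its points lie in the box [0, T]^d, and since the
   product is fixed at D > 0 positivity is automatic for nonnegative points.
   Hence the maximum exists, which gives (i), and (iii) is immediate.

   For (ii), suppose four of the coordinates other than lambda_1 have distinct
   values a < b < c < e.  Raise lambda_1 from x to y; by Newton's identities,
   keeping the three power sums and the product forces the new values of these
   four coordinates to be the roots of an explicit quartic whose coefficients
   depend continuously on y.  At y = x it is (z - a)(z - b)(z - c)(z - e), so its
   four sign changes on the positive axis persist for y slightly above x, and
   lambda_1 was not maximal.  Thus at a maximizer the coordinates other than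
   lambda_1 take at most three values. *)
Require Import Defs.
From mathcomp Require Import all_boot all_order all_algebra.
From mathcomp Require Import classical_sets boolp reals topology normedtype derive.
From mathcomp Require Import ring lra.

Set Implicit Arguments.
Unset Strict Implicit.
Unset Printing Implicit Defensive.

Import Order.TTheory GRing.Theory Num.Theory.
Import numFieldNormedType.Exports.
Local Open Scope ring_scope.

(** * Raising one coordinate with three power sums and the product fixed *)

(** Continuity at 0 gives each polynomial a radius of positivity, and a finite list has a least
    radius. This lets several strict sign conditions survive one common perturbation. *)
Lemma horner_gt0_right (R : realType) (ps : seq {poly R}) :
  (forall p, p \in ps -> 0 < p.[0]) ->
  exists2 t : R, 0 < t & forall p, p \in ps -> 0 < p.[t].
Proof.
move=> ps0.
have [e e0 He] : exists2 e : R, 0 < e &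
    forall p t, p \in ps -> 0 < t -> t < e -> 0 < p.[t].
  elim: ps ps0 => [_|p ps IH ps0]; first by exists 1.
  have [e e0 He] := IH (fun q hq => ps0 q (mem_behead (s := p :: ps) hq)).
  have /(cvgr_gt p.[0]) := @continuous_horner R p 0.
  move=> /(_ _ (ps0 p (mem_head _ _)))/nbhs_ballP[e' /= e'0 He'].
  exists (Num.min e e'); first by rewrite lt_min e0.
  move=> q t; rewrite inE lt_min => /predU1P[->|qps] t0 /andP[te te'].
    by apply: He'; rewrite /ball/= sub0r normrN gtr0_norm.
  exact: He.
exists (e / 2); first by rewrite divr_gt0.
by move=> p /He; apply; lra.
Qed.

(** The signs at 0, [x1], [x2], [x3], [x4] alternate, starting with [e4 > 0], so each of the four
    gaps contains a root. The monic quartic is then the product of the four linear factors, and the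
    identities are Vieta's. *)
Lemma quartic_positive_roots (R : rcfType) (e1 e2 e3 e4 x1 x2 x3 x4 : R) :
  let q z := z ^+ 4 - e1 * z ^+ 3 + e2 * z ^+ 2 - e3 * z + e4 in
  [/\ 0 < x1, x1 < x2, x2 < x3 & x3 < x4] ->
  0 < e4 -> q x1 < 0 -> 0 < q x2 -> q x3 < 0 -> 0 < q x4 ->
  exists r1 r2 r3 r4 : R,
    [/\ 0 < r1, 0 < r2, 0 < r3 & 0 < r4] /\
    [/\ r1 + r2 + r3 + r4 = e1,
        r1 * r2 + r1 * r3 + r1 * r4 + r2 * r3 + r2 * r4 + r3 * r4 = e2,
        r1 * r2 * r3 + r1 * r2 * r4 + r1 * r3 * r4 + r2 * r3 * r4 = e3 &
        r1 * r2 * r3 * r4 = e4].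
Proof.
move=> q [x10 x12 x23 x34] e40 q1 q2 q3 q4.
pose p : {poly R} := Poly [:: e4; - e3; e2; - e1; 1].
have pE z : p.[z] = q z by rewrite /p /q horner_Poly /=; ring.
have sp : size p = 5 by rewrite (@PolyK _ 1) //= oner_neq0.
have lp : lead_coef p = 1 by rewrite lead_coefE sp coef_Poly.
have ivt (a b : R) : a < b -> p.[a] * p.[b] < 0 -> exists2 r : R, a < r < b & root p r.
  move=> ab pab.
  (* A root in the closed interval is enough: a root at an endpoint would make the product of the
     end values 0. *)
  suff [r /andP[ar rb] pr] : exists2 r, a <= r <= b & root p r.
    exists r => //; move/rootP: pr => pr.
    rewrite !lt_neqAle ar rb !andbT.
    apply/andP; split; apply/eqP => E.
      by move: pab; rewrite E pr mul0r ltxx.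
    by move: pab; rewrite -E pr mulr0 ltxx.
  have [pa|pa] := lerP p.[a] 0.
    by apply: poly_ivt; [exact: ltW | rewrite pa /=; nra].
  have [||r ? ?] := @poly_ivt R (- p) a b.
  - exact: ltW.
  - by rewrite !hornerN; apply/andP; split; nra.
  by exists r => //; rewrite -rootN.
have [||r1 /andP[r1l r1r] pr1] := ivt 0 x1 => //.
  by rewrite !pE {1}/q; nra.
have [||r2 /andP[r2l r2r] pr2] := ivt x1 x2 => //; first by rewrite !pE; nra.
have [||r3 /andP[r3l r3r] pr3] := ivt x2 x3 => //; first by rewrite !pE; nra.
have [||r4 /andP[r4l r4r] pr4] := ivt x3 x4 => //; first by rewrite !pE; nra.
have ur : uniq [:: r1; r2; r3; r4].
  by rewrite /= !inE !negb_or /= !lt_eqF //; lra.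
have := @all_roots_prod_XsubC _ p [:: r1; r2; r3; r4] sp.
rewrite uniq_rootsE ur /= pr1 pr2 pr3 pr4 => /(_ isT isT).
rewrite lp scale1r => pP.
have qE z : q z = (z - r1) * (z - r2) * (z - r3) * (z - r4).
  by rewrite -pE pP !big_cons big_nil mulr1 !hornerM !hornerXsubC !mulrA.
exists r1, r2, r3, r4; split; first by split; lra.
(* Both sides of [qE] are monic quartics, so their difference has degree at most 3 and its four
   coefficients are determined linearly by four values. *)
have := (qE 0, qE 1, qE (-1), qE 2); rewrite /q => -[[[h0 h1] h2] h3].
by split; lra.
Qed.

Lemma raise_preserving_p1_p2_p3_prod (R : realType) (x a b c e : R) :
  0 < x -> 0 < a -> a < b -> b < c -> c < e ->
  exists y r1 r2 r3 r4 : R,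
    [/\ x < y, 0 < r1, 0 < r2, 0 < r3 & 0 < r4] /\
    [/\ forall k, (0 < k < 4)%N ->
          y ^+ k + (r1 ^+ k + (r2 ^+ k + (r3 ^+ k + r4 ^+ k))) =
          x ^+ k + (a ^+ k + (b ^+ k + (c ^+ k + e ^+ k))) &
        y * (r1 * (r2 * (r3 * r4))) = x * (a * (b * (c * e)))].
Proof.
move=> x0 a0 ab bc ce.
pose p k := a ^+ k + b ^+ k + c ^+ k + e ^+ k.
(* [s k y] is the power sum left for the four new values once [x] becomes [y]. Newton's identities
   turn these into [e1], [e2], [e3], while [e4] is forced by the product. *)
pose s k (y : R) := p k - (y ^+ k - x ^+ k).
pose e1 y := s 1 y.
pose e2 y := (s 1 y ^+ 2 - s 2 y) / 2.
pose e3 y := (s 1 y ^+ 3 - 3 * s 1 y * s 2 y + 2 * s 3 y) / 6.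
pose e4 y := a * b * c * e * x / y.
pose q y z := z ^+ 4 - e1 y * z ^+ 3 + e2 y * z ^+ 2 - e3 y * z + e4 y.
have q0 z : q x z = (z - a) * (z - b) * (z - c) * (z - e).
  by rewrite /q /e1 /e2 /e3 /e4 /s /p; field; exact: lt0r_neq0.
(* With [y = x + t], [Q z] is [y * q y z] as a polynomial in [t]: the factor [y] clears the
   denominator of [e4]. *)
pose Y : {poly R} := x%:P + 'X.
pose S k : {poly R} := (p k)%:P - (Y ^+ k - (x ^+ k)%:P).
pose Q z : {poly R} :=
  Y * ((z ^+ 4)%:P - S 1 * (z ^+ 3)%:P + (S 1 ^+ 2 - S 2) * (z ^+ 2 / 2)%:P
   - (S 1 ^+ 3 - 3%:P * S 1 * S 2 + 2%:P * S 3) * (z / 6)%:P)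
  + (a * b * c * e * x)%:P.
have QE z t : x + t != 0 -> (Q z).[t] = (x + t) * q (x + t) z.
  move=> xt; rewrite /q /e1 /e2 /e3 /e4 /s /Q /S /Y !(hornerD, hornerN, hornerX, hornerC, horner_exp, hornerM); field.
  exact: xt.
have Q0 z : (Q z).[0] = x * ((z - a) * (z - b) * (z - c) * (z - e)).
  by rewrite QE ?addr0 ?q0 // lt0r_neq0.
(* Sample points between consecutive roots of [q x], and one beyond the last root; there [q x] has
   signs -, +, -, +. *)
pose x1 := (a + b) / 2; pose x2 := (b + c) / 2; pose x3 := (c + e) / 2.
pose x4 := e + 1.
have ineqs : [/\ 0 < x1, x1 < x2, x2 < x3 & x3 < x4].
  by rewrite /x1 /x2 /x3 /x4; split; lra.
have [t t0 tQ] : exists2 t : R, 0 < t &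
    forall P, P \in [:: - Q x1; Q x2; - Q x3; Q x4] -> 0 < P.[t].
  apply: horner_gt0_right => P; rewrite !inE.
  case/or4P => /eqP ->; rewrite ?hornerN Q0 -?mulrN; apply: mulr_gt0 => //.
  - rewrite [ltRHS](_ : _ = (x1 - a) * ((b - x1) * ((c - x1) * (e - x1))));
      last by ring.
    by rewrite /x1; do !apply: mulr_gt0; lra.
  - rewrite [ltRHS](_ : _ = (x2 - a) * ((x2 - b) * ((c - x2) * (e - x2))));
      last by ring.
    by rewrite /x2; do !apply: mulr_gt0; lra.
  - rewrite [ltRHS](_ : _ = (x3 - a) * ((x3 - b) * ((x3 - c) * (e - x3))));
      last by ring.
    by rewrite /x3; do !apply: mulr_gt0; lra.
  - by rewrite /x4; do !apply: mulr_gt0; lra.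
have y0 : 0 < x + t by lra.
have qQ z : q (x + t) z = (Q z).[t] / (x + t).
  by rewrite QE ?lt0r_neq0 // mulrC mulKf // lt0r_neq0.
have sgn z : 0 < (Q z).[t] -> 0 < q (x + t) z.
  by rewrite qQ => ?; rewrite divr_gt0.
have sgnN z : 0 < (- Q z).[t] -> q (x + t) z < 0.
  by rewrite qQ hornerN oppr_gt0 => ?; rewrite pmulr_llt0 ?invr_gt0.
have e40 : 0 < e4 (x + t) by rewrite divr_gt0 //; do !apply: mulr_gt0; lra.
have [] := quartic_positive_roots ineqs e40
  (e1 := e1 (x + t)) (e2 := e2 (x + t)) (e3 := e3 (x + t)).
- by apply/sgnN/tQ; rewrite !inE eqxx.
- by apply/sgn/tQ; rewrite !inE eqxx !orbT.
- by apply/sgnN/tQ; rewrite !inE eqxx !orbT.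
- by apply/sgn/tQ; rewrite !inE eqxx !orbT.
move=> r1 [r2 [r3 [r4 [[r10 r20 r30 r40] [E1 E2 E3 E4]]]]].
exists (x + t), r1, r2, r3, r4; split; first by split; lra.
(* Newton's identities in reverse: the elementary symmetric functions of the roots give back their
   power sums. *)
have s1 : s 1 (x + t) = r1 + r2 + r3 + r4 by [].
have s2 : s 2 (x + t) = r1 ^+ 2 + r2 ^+ 2 + r3 ^+ 2 + r4 ^+ 2.
  by move: E2; rewrite /e2 s1 => E2; lra.
have s3 : s 3 (x + t) = r1 ^+ 3 + r2 ^+ 3 + r3 ^+ 3 + r4 ^+ 3.
  by move: E3; rewrite /e3 s1 s2 => E3; lra.
split; last first.
  rewrite !mulrA -4!mulrA mulrC !mulrA E4 /e4 -!mulrA mulVf ?lt0r_neq0 //.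
  by ring.
move: s1 s2 s3; rewrite /s /p => s1 s2 s3.
by case=> [|[|[|[|]]]] // _; lra.
Qed.

(** * Compactness and existence of a maximizer *)

Lemma continuous_power_sum_row (R : realType) (d k : nat) :
  continuous (fun v : 'rV[R]_d => \sum_i v 0 i ^+ k).
Proof.
apply: continuous_big => [[x y]|i _ v]; first exact: add_continuous.
apply: (@continuous_comp _ _ _ (fun v : 'rV[R]_d => v 0 i) (fun x => x ^+ k)).
  exact: coord_continuous.
rewrite (_ : (fun x => _) = horner 'X^k); first exact: continuous_horner.
by apply/funext => x; rewrite hornerXn.
Qed.

Lemma continuous_prod_row (R : realType) (d : nat) :
  continuous (fun v : 'rV[R]_d => \prod_i v 0 i).
Proof.
apply: continuous_big => [[x y]|i _]; first exact: mul_continuous.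
exact: coord_continuous.
Qed.

Lemma F4_has_maximizer (R : realType) (d : nat) (T S p3 D : R)
    (lam : d.-tuple R) : F4 T S p3 D lam ->
  exists2 mu : d.-tuple R, F4 T S p3 D mu &
    forall nu : d.-tuple R, F4 T S p3 D nu -> nu`_0 <= mu`_0.
Proof.
move=> Flam.
have [d0|d_gt0] := posnP d.
  (* For [d = 0] every first coordinate is the default value 0. *)
  exists lam => // nu _.
  by rewrite !nth_default ?size_tuple ?d0.
pose i0 : 'I_d := Ordinal d_gt0.
have D0 : 0 < D.
  by case: Flam => lam0 _ _ _ <-; rewrite big_tuple; apply: prodr_gt0.
pose tup (v : 'rV[R]_d) : d.-tuple R := [tuple v 0 i | i < d].
pose row (nu : d.-tuple R) : 'rV[R]_d := \row_i tnth nu i.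
have tupE (v : 'rV[R]_d) (f : R -> R) : \sum_(x <- tup v) f x = \sum_i f (v 0 i).
  by rewrite big_tuple; apply: eq_bigr => i _; rewrite tnth_mktuple.
have tupP (v : 'rV[R]_d) : \prod_(x <- tup v) x = \prod_i v 0 i.
  by rewrite big_tuple; apply: eq_bigr => i _; rewrite tnth_mktuple.
have rowK nu : tup (row nu) = nu.
  by apply: eq_from_tnth => i; rewrite tnth_mktuple mxE.
have tup0 (v : 'rV[R]_d) : (tup v)`_0 = v 0 i0.
  by rewrite -(tnth_nth 0 (tup v) i0) tnth_mktuple.
pose box : set 'rV[R]_d := [set v | forall i, `[0, T]%classic (v ord0 i)]%classic.
pose eqs : set 'rV[R]_d :=
  ([set v | \sum_i v 0 i ^+ 1 = T] `&` [set v | \sum_i v 0 i ^+ 2 = S] `&`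
   [set v | \sum_i v 0 i ^+ 3 = p3] `&` [set v | \prod_i v 0 i = D])%classic.
have cl (f : 'rV[R]_d -> R) y : continuous f -> closed [set v | f v = y]%classic.
  move=> cf; apply: (@preimage_closed _ _ f [set x | x = y]%classic).
    by move=> ? _; exact: cf.
  exact: closed_eq.
have cK : compact (box `&` eqs)%classic.
  apply: compact_closedI.
    by apply: (@rV_compact _ _ (fun=> `[0, T]%classic)) => _; exact: segment_compact.
  do !apply: closedI; apply: cl;
    solve [exact: continuous_power_sum_row | exact: continuous_prod_row].
(* Forward, a zero coordinate would make the product 0 instead of [D]. Backward, a coordinate is at
   most [T] because the others are positive. *)
have KF (v : 'rV[R]_d) : (box `&` eqs)%classic v <-> F4 T S p3 D (tup v).
  rewrite /F4 /= /power_sum !tupE tupP; split.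
    case=> vbox [[[? ?] ?] vD]; split => // i.
    have /andP[v0 _] : 0 <= v 0 i <= T by have := vbox i; rewrite /= in_itv.
    rewrite tnth_mktuple lt_neqAle v0 andbT eq_sym; apply: contraTneq D0 => vi0.
    by rewrite -vD (bigD1 i) //= vi0 mul0r ltxx.
  case=> v0 vT ? ? ?; split => // i; rewrite /= in_itv /=.
  have {}v0 j : 0 < v 0 j by have := v0 j; rewrite tnth_mktuple.
  rewrite ltW //= -vT (bigD1 i) //= expr1 lerDl.
  by apply: sumr_ge0 => j _; rewrite expr1 ltW.
have [||v] := @EVT_max_rV R d (fun v => v 0 i0) _ _ cK.
- by exists (row lam); apply/KF; rewrite rowK.
- by apply: continuous_subspaceT; exact: coord_continuous.
rewrite inE => /KF Fv vmax; exists (tup v) => // nu Fnu.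
by rewrite -[nu]rowK !tup0; apply: vmax; rewrite inE; apply/KF; rewrite rowK.
Qed.

Lemma B4plus_max (R : realType) (d : nat) (T S p3 D : R) (lam : d.-tuple R) :
  F4 T S p3 D lam ->
  (forall mu : d.-tuple R, F4 T S p3 D mu -> mu`_0 <= lam`_0) ->
  B4plus d T S p3 D = lam`_0.
Proof.
move=> Flam lam_max; rewrite /B4plus; case: xgetP => [b -> [[mu Fmu <-] ub]|].
  by apply/eqP; rewrite eq_le lam_max //=; apply: ub; exists lam.
(* The default branch of [xget] is impossible, as [lam] attains the maximum. *)
move=> /(_ lam`_0) []; split; first by exists lam.
by move=> _ [mu Fmu <-]; exact: lam_max.
Qed.

Lemma F4_le_B4plus (R : realType) (d : nat) (T S p3 D : R) (lam : d.-tuple R) :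
  F4 T S p3 D lam -> lam`_0 <= B4plus d T S p3 D.
Proof.
move=> Flam; have [mu Fmu mu_max] := F4_has_maximizer Flam.
by rewrite (B4plus_max Fmu mu_max); exact: mu_max.
Qed.

(** * The number of distinct values at a maximizer *)

Lemma exists_larger_head (R : realType) (x : R) (s : seq R) :
  0 < x -> {in s, forall z, 0 < z} -> (4 <= size (undup s))%N ->
  exists y s', [/\ x < y, {in s', forall z, 0 < z}, size s' = size s,
    forall k, (0 < k < 4)%N -> power_sum k (y :: s') = power_sum k (x :: s) &
    \prod_(z <- y :: s') z = \prod_(z <- x :: s) z].
Proof.
move=> x0 s0 s4.
(* One copy of each of four distinct values is taken out; [w] keeps all other entries, repetitions
   included. *)
have [w] : {w | perm_eq s (take 4 (undup s) ++ w)}.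
  exact/perm_to_subseq/(subseq_trans (take_subseq _ _))/undup_subseq.
pose u := sort <=%R (take 4 (undup s)).
move=> sw0.
have sw : perm_eq s (u ++ w).
  by rewrite (perm_trans sw0) // perm_cat2r perm_sym perm_sort.
have : size u = 4 by rewrite size_sort size_takel.
have : sorted <%R u by rewrite sort_lt_sorted take_uniq ?undup_uniq.
case: u sw => [|a [|b [|c [|e []]]]] //= sw /and4P[ab bc ce _] _.
have a0 : 0 < a by apply: s0; rewrite (perm_mem sw) mem_head.
have [y [r1 [r2 [r3 [r4 [[xy r10 r20 r30 r40] [psum prod]]]]]]] :=
  raise_preserving_p1_p2_p3_prod x0 a0 ab bc ce.
exists y, [:: r1, r2, r3, r4 & w]; split => //.
- move=> z; rewrite !inE => /or4P[/eqP->|/eqP->|/eqP->|/orP[/eqP->|zw]] //.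
  by apply: s0; rewrite (perm_mem sw) !inE zw !orbT.
- by rewrite (perm_size sw).
- move=> k /psum; rewrite /power_sum !big_cons (perm_big _ sw) !big_cons /= => E.
  by lra.
rewrite !big_cons (perm_big _ sw) !big_cons /=.
by rewrite !mulrA in prod *; rewrite prod.
Qed.

Lemma F4_maximizer_undup (R : realType) (d : nat) (T S p3 D : R)
    (lam : d.-tuple R) : F4 T S p3 D lam ->
  (forall mu : d.-tuple R, F4 T S p3 D mu -> mu`_0 <= lam`_0) ->
  (size (undup lam) <= 4)%N.
Proof.
case: d lam => [|d] lam; first by case: lam => -[].
case/tupleP: lam => x s; rewrite /F4 /= => -[lam0 psT psS psp3 prD] lam_max.
have pos z : z \in [tuple of x :: s] -> 0 < z by case/tnthP => i ->.
rewrite leqNgt; apply/negP => large.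
have [|||y [s' [xy s'0 size_s' psum prod]]] := @exists_larger_head R x s.
- by apply: pos; rewrite mem_head.
- by move=> z zs; apply: pos; rewrite inE zs orbT.
(* Five distinct values in [x :: s] leave at least four in [s], whether or not [x] recurs there. *)
- by move: large => /=; case: ifP => _ //=; exact: ltnW.
(* [F4] imposes no order on the coordinates, so [y :: s'] competes with [x :: s] as it stands. *)
have sz : size (y :: s') == d.+1 by rewrite /= size_s' size_tuple.
have := lam_max (Tuple sz); rewrite leNgt xy => /(_ _)/negP; apply => //.
split; rewrite ?psum ?prod // => i.
have := mem_tnth i (Tuple sz); rewrite inE => /predU1P[->|/s'0 //].
by apply: lt_trans xy; apply: pos; rewrite mem_head.
Qed.

Theorem theorem6p4 (R : realType) (m n : nat) (hm : (2 <= m)%N) (hn : (0 < n)%N)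
    (A : tensor R m n) (hsym : tensor_sym A) (hpos : tensor_posdef A)
    (lam : (n * m.-1 ^ n.-1).-tuple R) (hspec : H_spectrum A lam)
    (hsorted : sorted >=%R lam) (hlam : forall i, 0 < tnth lam i) :
  let d := (n * m.-1 ^ n.-1)%N in
  let T := power_sum 1 lam in
  let S := power_sum 2 lam in
  let p3 := power_sum 3 lam in
  let D := \prod_(x <- lam) x in
  let lam_max := lam`_0 in
  [/\ B4plus d T S p3 D >= lam_max,
      (B4plus d T S p3 D = lam_max -> (size (undup lam) <= 4)%N) &
      ((size (undup lam) <= 4)%N -> unique_maximizer T S p3 D lam ->
       B4plus d T S p3 D = lam_max)].
Proof.
move=> d T S p3 D lam_max.
have Flam : F4 T S p3 D lam by [].
split; first exact: F4_le_B4plus.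
(* Equality makes [lam] itself a maximizer, because [B4plus] bounds every first coordinate. *)
- move=> maxE; apply: (F4_maximizer_undup Flam) => mu Fmu.
  by rewrite -[lam`_0]maxE; exact: F4_le_B4plus.
- by move=> _ [_ ub _]; exact: B4plus_max.
Qed.
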